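(* Let $X$ be a nonempty proper metric space. Then $X$ is an asymptotic cone of some metric space $Y$, i.e. there exist a metric space $Y$, a point $p\in{}^*Y$ and $\nu\in{}^*\mathbb{R}$ with $\nu\gg1$ such that $X$ is isometric to $C(Y,p,\nu)$. If moreover $X$ is geodesic and unbounded, then $Y$ can be chosen to be geodesic as well.
   Context: Nonstandard extensions. Fix a non-principal ultrafilter $\mathcal{U}$ on $\mathbb{N}$. For a set $X$, ${}^*X$ is the ultrapower $X^{\mathbb{N}}/\mathcal{U}$ (functions identified if they agree on a set in $\mathcal{U}$), with $X\subseteq{}^*X$ via constant functions; functions and relations (in particular the order and operations of $\mathbb{R}$ and the metric $d$ of a metric space, giving $d:{}^*X\times{}^*X\to{}^*\mathbb{R}$) are extended componentwise modulo $\mathcal{U}$. For $\xi,\eta\in{}^*\mathbb{R}$, $\eta\neq 0$: $\xi\in o(\eta)$ means $\xi/\eta$ is infinitesimal; $\xi\in O(\eta)$ means $\xi/\eta$ is finite, i.e. bounded in absolute value by a standard real; $\xi\gg\eta$ means $\xi,\eta$ are nonnegative and $\xi/\eta$ is infinite. For finite $\xi\in{}^*\mathbb{R}$, $st(\xi)$ is the unique real with $\xi-st(\xi)$ infinitesimal. Asymptotic cones. Let $(Y,d)$ be a metric space, $p\in{}^*Y$ (basepoint) and $\nu\in{}^*\mathbb{R}$, $\nu\gg 1$ (scaling factor). On ${}^*Y$ put $x\sim y\iff d(x,y)\in o(\nu)$. The asymptotic cone is $C(Y,p,\nu)=\{[x]\in{}^*Y/{\sim}\,:\, d(x,p)\in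 O(\nu)\}$ with metric $d([x],[y])=st(d(x,y)/\nu)$. A metric space is proper if all its closed balls are compact. A metric space $X$ is geodesic if for all $x,y\in X$ there is a map $\gamma:[0,l]\to X$ from $x$ to $y$ with $d(\gamma(t),\gamma(s))=|t-s|$ for all $t,s\in[0,l]$. *)

(* Defs.v *)
From HB Require Import structures.
From mathcomp Require Import all_boot all_order all_algebra.
From mathcomp Require Import ring lra.
From mathcomp Require Import all_classical all_reals all_analysis.

Set Implicit Arguments.
Unset Strict Implicit.
Unset Printing Implicit Defensive.

Import Order.TTheory GRing.Theory Num.Theory.
Import numFieldNormedType.Exports.

Local Open Scope classical_set_scope.
Local Open Scope ring_scope.
Local Open Scope quotient_scope.

Record nonprincipal_ultrafilter := NonprincipalUltrafilter {
  ufilter :> set_system nat ;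
  ufilter_ultra : UltraFilter ufilter ;
  ufilter_nonprincipal : forall n : nat, ufilter <> principal_filter n
}.

#[global] Existing Instance ufilter_ultra.

Section Ultrapower.
Variable U : nonprincipal_ultrafilter.

Definition ae_eq_rel (X : Type) (x y : nat -> X) : bool :=
  `[< \forall n \near ufilter U, x n = y n >].

Section AeEq.
Variable X : Type.

Lemma ae_eq_rel_refl : reflexive (@ae_eq_rel X).
Proof. by move=> x; apply/asboolP; near=> n. Unshelve. all: by end_near. Qed.

Lemma ae_eq_rel_sym : symmetric (@ae_eq_rel X).
Proof.
by move=> x y; apply/asbool_equiv_eq; split; apply: filterS => n /esym.
Qed.

Lemma ae_eq_rel_trans : transitive (@ae_eq_rel X).
Proof.
move=> y x z /asboolP xy /asboolP yz; apply/asboolP.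
by apply: filterS2 xy yz => n -> ->.
Qed.

Canonical ae_eq_equiv :=
  EquivRel (@ae_eq_rel X) ae_eq_rel_refl ae_eq_rel_sym ae_eq_rel_trans.

End AeEq.

Definition star (X : choiceType) : choiceType :=
  {eq_quot (@ae_eq_equiv X)}.

Definition star_class (X : choiceType) (x : nat -> X) : star X :=
  \pi_({eq_quot (@ae_eq_equiv X)}) x.

Definition star_repr (X : choiceType) (x : star X) : nat -> X :=
  repr (x : {eq_quot (@ae_eq_equiv X)}).

Definition star_const (X : choiceType) (x : X) : star X :=
  star_class (fun=> x).

(* Componentwise extensions, computed on chosen representatives; the lemmas
   [star_map_class], [star_map2_class] and [star_rel_class] below show that
   any representatives may be used. *)
Definition star_map (X Y : choiceType) (f : X -> Y) (x : star X) : star Y :=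
  star_class (fun n => f (star_repr x n)).

Definition star_map2 (X Y Z : choiceType) (f : X -> Y -> Z)
    (x : star X) (y : star Y) : star Z :=
  star_class (fun n => f (star_repr x n) (star_repr y n)).

Definition star_rel (X Y : choiceType) (r : X -> Y -> Prop)
    (x : star X) (y : star Y) : Prop :=
  \forall n \near ufilter U, r (star_repr x n) (star_repr y n).

Lemma star_classP (X : choiceType) (x y : nat -> X) :
  star_class x = star_class y <-> \forall n \near ufilter U, x n = y n.
Proof.
split; first by move/eqmodP/asboolP.
by move=> xy; apply/eqmodP/asboolP.
Qed.

Lemma star_reprK (X : choiceType) (x : star X) : star_class (star_repr x) = x.
Proof. exact: reprK. Qed.

Lemma star_repr_class (X : choiceType) (x : nat -> X) :
  \forall n \near ufilter U, star_repr (star_class x) n = x n.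
Proof. by apply/star_classP; rewrite star_reprK. Qed.

Lemma star_map_class (X Y : choiceType) (f : X -> Y) (x : nat -> X) :
  star_map f (star_class x) = star_class (fun n => f (x n)).
Proof. by apply/star_classP; apply: filterS (star_repr_class x) => n ->. Qed.

Lemma star_map2_class (X Y Z : choiceType) (f : X -> Y -> Z)
    (x : nat -> X) (y : nat -> Y) :
  star_map2 f (star_class x) (star_class y) = star_class (fun n => f (x n) (y n)).
Proof.
apply/star_classP.
by apply: filterS2 (star_repr_class x) (star_repr_class y) => n -> ->.
Qed.

Lemma star_rel_class (X Y : choiceType) (r : X -> Y -> Prop)
    (x : nat -> X) (y : nat -> Y) :
  star_rel r (star_class x) (star_class y) <->
  \forall n \near ufilter U, r (x n) (y n).
Proof.
split.
  by apply: filterS3 (star_repr_class x) (star_repr_class y) => n -> ->.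
by apply: filterS3 (star_repr_class x) (star_repr_class y) => n -> ->.
Qed.

Section Hyperreals.
Variable R : realType.
Implicit Types (xi eta : star R).

Definition star_sub : star R -> star R -> star R :=
  star_map2 (fun a b : R => a - b).
Definition star_div : star R -> star R -> star R :=
  star_map2 (fun a b : R => a / b).
Definition star_norm : star R -> star R := star_map (fun a : R => `|a|).
Definition star_le : star R -> star R -> Prop :=
  star_rel (fun a b : R => a <= b).
Definition star_lt : star R -> star R -> Prop :=
  star_rel (fun a b : R => a < b).

Definition infinitesimal xi : Prop :=
  forall e : R, 0 < e -> star_lt (star_norm xi) (star_const e).

Definition finite_star xi : Prop :=
  exists r : R, star_le (star_norm xi) (star_const r).

(* These three notions are only meaningful for eta <> 0. *)
Definition star_littleo xi eta : Prop := infinitesimal (star_div xi eta).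
Definition star_bigO xi eta : Prop := finite_star (star_div xi eta).
Definition star_gg xi eta : Prop :=
  [/\ star_le (star_const 0) xi, star_le (star_const 0) eta &
      ~ finite_star (star_div xi eta)].

Definition st xi : R :=
  xget 0 [set a : R | infinitesimal (star_sub xi (star_const a))].

Lemma infinitesimal_class (x : nat -> R) : infinitesimal (star_class x) <->
  forall e : R, 0 < e -> \forall n \near ufilter U, `|x n| < e.
Proof.
rewrite /infinitesimal /star_lt /star_norm star_map_class.
split=> h e e0; first by have /star_rel_class := h e e0.
by apply/star_rel_class; exact: h.
Qed.

Lemma finite_class (x : nat -> R) : finite_star (star_class x) <->
  exists r : R, \forall n \near ufilter U, `|x n| <= r.
Proof.
rewrite /finite_star /star_le /star_norm star_map_class.
split=> -[r h]; exists r; first by move/star_rel_class: h.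
by apply/star_rel_class.
Qed.

Lemma infinitesimal_sub_uniq xi (a b : R) :
  infinitesimal (star_sub xi (star_const a)) ->
  infinitesimal (star_sub xi (star_const b)) -> a = b.
Proof.
rewrite -[xi]star_reprK; set x := star_repr xi.
rewrite /star_sub !star_map2_class => /infinitesimal_class xa
  /infinitesimal_class xb.
apply/eqP; rewrite -subr_eq0 -normr_le0; apply/ler_addgt0Pl => e e0; rewrite addr0.
have e2 : 0 < e / 2 by rewrite divr_gt0.
have [n [h1 h2]] := filter_ex (filterI (xa _ e2) (xb _ e2)).
have -> : a - b = (x n - b) - (x n - a) by ring.
rewrite (le_trans (ler_normB _ _))// [leRHS]splitr.
by rewrite lerD// ltW.
Qed.

Lemma stP xi : finite_star xi ->
  infinitesimal (star_sub xi (star_const (st xi))).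
Proof.
move=> fxi; apply: (@xgetPex _ 0
  [set a : R | infinitesimal (star_sub xi (star_const a))]).
move: fxi; rewrite -[xi]star_reprK; set x := star_repr xi.
move=> /finite_class[r xr].
pose F : set_system R := x @ ufilter U.
have FF : ProperFilter F by exact: fmap_proper_filter.
have Fr : F `[- r, r]%classic.
  by apply: filterS xr => n /=; rewrite ler_norml in_itv.
have [a [_ cFa]] := @segment_compact R (- r) r F FF Fr.
exists a; rewrite /= /star_sub star_map2_class; apply/infinitesimal_class => e e0.
have [//|nUe] := in_ultra_setVsetC [set n | `|x n - a| < e]
  (ufilter_ultra U).
have [y [ay ya]] : ([set y : R | ~ `|y - a| < e] `&` ball a e) !=set0.
  by apply: cFa; [exact: nUe|exact: nbhsx_ballx].
by move: ya; rewrite /ball /= distrC.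
Qed.

Lemma st_class (x : nat -> R) (a : R) :
  (forall e : R, 0 < e -> \forall n \near ufilter U, `|x n - a| < e) ->
  st (star_class x) = a.
Proof.
move=> xa.
have ia : infinitesimal (star_sub (star_class x) (star_const a)).
  by rewrite /star_sub star_map2_class; apply/infinitesimal_class.
apply: xget_unique => // b ib.
exact: infinitesimal_sub_uniq ib ia.
Qed.

End Hyperreals.
End Ultrapower.

Arguments star_const U {X} x.

Section AsymptoticCone.
Variables (U : nonprincipal_ultrafilter) (R : realType) (Y : metricType R).

Definition star_dist : star U Y -> star U Y -> star U R :=
  star_map2 (fun x y : Y => mdist x y : R).

Section ScaledEquivalence.
Variable nu : star U R.

Definition cone_rel (x y : star U Y) : bool :=
  `[< star_littleo (star_dist x y) nu >].

Lemma star_littleo_dist (x y : star U Y) :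
  star_littleo (star_dist x y) nu <->
  forall e : R, 0 < e -> \forall n \near ufilter U,
    mdist (star_repr x n) (star_repr y n) / `|star_repr nu n| < e.
Proof.
rewrite /star_littleo /star_div /star_dist -{1}[nu]star_reprK star_map2_class.
split=> [/infinitesimal_class h e e0|h].
  apply: filterS (h e e0) => n.
  by rewrite normrM normfV ger0_norm ?mdist_ge0.
apply/infinitesimal_class => e e0; apply: filterS (h e e0) => n.
by rewrite normrM normfV (@ger0_norm _ (mdist _ _)) ?mdist_ge0.
Qed.

Lemma cone_rel_refl : reflexive cone_rel.
Proof.
move=> x; apply/asboolP/star_littleo_dist => e e0.
by near=> n; rewrite mdistxx mul0r.
Unshelve. all: by end_near. Qed.

Lemma cone_rel_sym : symmetric cone_rel.
Proof.
move=> x y; rewrite /cone_rel /star_dist /star_map2.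
by under eq_fun do rewrite metric_sym.
Qed.

Lemma cone_rel_trans : transitive cone_rel.
Proof.
move=> y x z /asboolP/star_littleo_dist xy /asboolP/star_littleo_dist yz.
apply/asboolP/star_littleo_dist => e e0.
have e2 : 0 < e / 2 by rewrite divr_gt0.
apply: filterS2 (xy _ e2) (yz _ e2) => n h1 h2.
rewrite [ltRHS]splitr; apply: le_lt_trans (ltrD h1 h2).
by rewrite -mulrDl ler_wpM2r ?invr_ge0// metric_triangle.
Qed.

Canonical cone_equiv :=
  EquivRel cone_rel cone_rel_refl cone_rel_sym cone_rel_trans.

Definition cone_quot : choiceType := {eq_quot cone_equiv}.

Definition cone_class (x : star U Y) : cone_quot :=
  \pi_({eq_quot cone_equiv}) x.

Lemma cone_classP (x y : star U Y) :
  cone_class x = cone_class y <-> star_littleo (star_dist x y) nu.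
Proof.
split; first by move/eqmodP/asboolP.
by move=> xy; apply/eqmodP/asboolP.
Qed.

End ScaledEquivalence.

Variables (p : star U Y) (nu : star U R).

(* The proof that nu >> 1 is an argument of the type because the metric
   structure below depends on it. *)
Definition cone (nu_gg1 : star_gg nu (star_const U (1 : R))) : Type :=
  set_type [set cone_class nu x | x in
    [set x : star U Y | star_bigO (star_dist x p) nu]].

Variable nu_gg1 : star_gg nu (star_const U (1 : R)).

HB.instance Definition _ := Choice.copy (cone nu_gg1)
  (set_type [set cone_class nu x | x in
    [set x : star U Y | star_bigO (star_dist x p) nu]]).

Definition cone_point (x : star U Y)
    (xp : star_bigO (star_dist x p) nu) : cone nu_gg1 :=
  SigSub (mem_set (imageP (cone_class nu) xp)).

Definition cone_repr (u : cone nu_gg1) : star U Y :=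
  repr (\val u : {eq_quot (cone_equiv nu)}).

(* Computed on chosen representatives; see [cone_dist_point]. *)
Definition cone_dist (u v : cone nu_gg1) : R :=
  st (star_div (star_dist (cone_repr u) (cone_repr v)) nu).

Lemma star_bigO_dist (x y : star U Y) :
  star_bigO (star_dist x y) nu <->
  exists r : R, \forall n \near ufilter U,
    mdist (star_repr x n) (star_repr y n) / star_repr nu n <= r.
Proof.
have nu0 : \forall n \near ufilter U, 0 <= star_repr nu n.
  by case: nu_gg1 => + _ _; rewrite -{1}[nu]star_reprK => /star_rel_class.
rewrite /star_bigO /star_div /star_dist -{1}[nu]star_reprK star_map2_class.
split=> [/finite_class[r h]|[r h]].
  by exists r; apply: filterS h => n; apply: le_trans; exact: ler_norm.
apply/finite_class; exists r; apply: filterS2 nu0 h => n n0.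
by rewrite ger0_norm// divr_ge0// mdist_ge0.
Qed.

Lemma cone_dist_finite (x y : star U Y) :
  star_bigO (star_dist x p) nu -> star_bigO (star_dist y p) nu ->
  star_bigO (star_dist x y) nu.
Proof.
have nu0 : \forall n \near ufilter U, 0 <= star_repr nu n.
  by case: nu_gg1 => + _ _; rewrite -{1}[nu]star_reprK => /star_rel_class.
move=> /star_bigO_dist[r hr] /star_bigO_dist[s hs].
apply/star_bigO_dist; exists (r + s); apply: filterS3 nu0 hr hs => n n0 h1 h2.
apply: le_trans (lerD h1 h2); rewrite -mulrDl ler_wpM2r ?invr_ge0//.
by rewrite (metric_sym (star_repr y n)) metric_triangle.
Qed.

Lemma st_distP (x y : star U Y) : star_bigO (star_dist x y) nu ->
  forall e : R, 0 < e -> \forall n \near ufilter U,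
    `|mdist (star_repr x n) (star_repr y n) / star_repr nu n
      - st (star_div (star_dist x y) nu)| < e.
Proof.
move=> /stP; move: (st _) => a.
rewrite /star_div /star_dist -{1}[nu]star_reprK !star_map2_class.
by rewrite /star_sub star_map2_class => /infinitesimal_class.
Qed.

Lemma st_dist_eqmod (x x' y y' : star U Y) :
  star_bigO (star_dist x y) nu ->
  star_littleo (star_dist x x') nu -> star_littleo (star_dist y y') nu ->
  st (star_div (star_dist x y) nu) = st (star_div (star_dist x' y') nu).
Proof.
have nu0 : \forall n \near ufilter U, 0 <= star_repr nu n.
  by case: nu_gg1 => + _ _; rewrite -{1}[nu]star_reprK => /star_rel_class.
move=> /st_distP xy /star_littleo_dist xx' /star_littleo_dist yy'.
set a := st (star_div (star_dist x y) nu) in xy *; apply/esym.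
rewrite /star_div /star_dist -[nu]star_reprK !star_map2_class.
apply: st_class => e e0.
have e3 : 0 < e / 3 by rewrite divr_gt0.
have xe := xx' _ e3; have ye := yy' _ e3.
apply: filterS3 (filterI nu0 (xy _ e3)) xe ye => n [n0].
rewrite !(ger0_norm n0) => h1 h2 h3.
set c := star_repr nu n in n0 h1 h2 h3 *.
have c0 : 0 <= c^-1 by rewrite invr_ge0.
set s := star_repr x n in h1 h2 *; set s' := star_repr x' n in h2 *.
set t := star_repr y n in h1 h3 *; set t' := star_repr y' n in h3 *.
have k1 : mdist s t / c <= mdist s s' / c + mdist s' t' / c + mdist t t' / c.
  rewrite -!mulrDl ler_wpM2r// (le_trans (metric_triangle _ s' _))//.
  by rewrite -addrA lerD2l (metric_sym t) metric_triangle.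
have k2 : mdist s' t' / c <= mdist s s' / c + mdist s t / c + mdist t t' / c.
  rewrite -!mulrDl ler_wpM2r// (le_trans (metric_triangle _ s _))//.
  by rewrite -addrA (metric_sym s') lerD2l metric_triangle.
move: h1; rewrite !ltr_norml => /andP[h4 h5]; apply/andP; split.
  by lra.
by lra.
Qed.

Lemma cone_class_repr (u : cone nu_gg1) : cone_class nu (cone_repr u) = \val u.
Proof. exact: reprK. Qed.

Lemma cone_reprP (u : cone nu_gg1) : star_bigO (star_dist (cone_repr u) p) nu.
Proof.
have [x xp xu] := set_mem (valP u).
have /cone_classP h : cone_class nu (cone_repr u) = cone_class nu x.
  by rewrite cone_class_repr xu.
have nu0 : \forall n \near ufilter U, 0 <= star_repr nu n.
  by case: nu_gg1 => + _ _; rewrite -{1}[nu]star_reprK => /star_rel_class.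
move: xp => /star_bigO_dist[r hr]; move/star_littleo_dist/(_ _ ltr01): h => h.
apply/star_bigO_dist; exists (1 + r).
apply: filterS3 nu0 hr h => n n0 h1; rewrite (ger0_norm n0) => /ltW h2.
apply: le_trans (lerD h2 h1); rewrite -mulrDl ler_wpM2r ?invr_ge0//.
by rewrite metric_triangle.
Qed.

Lemma cone_repr_dist (u v : cone nu_gg1) :
  star_bigO (star_dist (cone_repr u) (cone_repr v)) nu.
Proof. by apply: cone_dist_finite; exact: cone_reprP. Qed.

Lemma cone_dist_point (x y : star U Y) (xp : star_bigO (star_dist x p) nu)
    (yp : star_bigO (star_dist y p) nu) :
  cone_dist (cone_point xp) (cone_point yp) = st (star_div (star_dist x y) nu).
Proof.
apply: st_dist_eqmod; first exact: cone_repr_dist.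
  by apply/cone_classP; rewrite cone_class_repr.
by apply/cone_classP; rewrite cone_class_repr.
Qed.

Lemma cone_distxx (u : cone nu_gg1) : cone_dist u u = 0.
Proof.
rewrite /cone_dist /star_div /star_dist -[nu]star_reprK !star_map2_class.
apply: st_class => e e0; near=> n.
by rewrite mdistxx mul0r subr0 normr0.
Unshelve. all: by end_near. Qed.

Lemma cone_dist_positivity (u v : cone nu_gg1) : cone_dist u v = 0 -> u = v.
Proof.
move=> uv; apply: val_inj; rewrite -!cone_class_repr; apply/cone_classP.
apply/star_littleo_dist => e e0.
have := st_distP (cone_repr_dist u v) e0; rewrite -/(cone_dist u v) uv.
apply: filterS => n; rewrite subr0 normrM normfV.
by rewrite (@ger0_norm _ (mdist _ _)) ?mdist_ge0.
Qed.

Lemma cone_dist_sym (u v : cone nu_gg1) : cone_dist u v = cone_dist v u.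
Proof.
rewrite /cone_dist /star_dist /star_map2.
by under eq_fun do rewrite metric_sym.
Qed.

Lemma cone_dist_triangle (v u w : cone nu_gg1) :
  cone_dist u w <= cone_dist u v + cone_dist v w.
Proof.
have nu0 : \forall n \near ufilter U, 0 <= star_repr nu n.
  by case: nu_gg1 => + _ _; rewrite -{1}[nu]star_reprK => /star_rel_class.
apply/ler_addgt0Pr => e e0; have e3 : 0 < e / 3 by rewrite divr_gt0.
have h1 := st_distP (cone_repr_dist u w) e3.
have h2 := st_distP (cone_repr_dist u v) e3.
have h3 := st_distP (cone_repr_dist v w) e3.
have [n [[n0 k1] [k2 k3]]] :=
  filter_ex (filterI (filterI nu0 h1) (filterI h2 h3)).
move: k1 k2 k3; rewrite -/(cone_dist u w) -/(cone_dist u v) -/(cone_dist v w).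
set c := star_repr nu n in n0 *.
set x := star_repr _ n; set z := star_repr _ n; set y := star_repr _ n.
have tri : mdist x z / c <= mdist x y / c + mdist y z / c.
  by rewrite -mulrDl ler_wpM2r ?invr_ge0// metric_triangle.
rewrite !ltr_norml => /andP[a1 a2] /andP[b1 b2] /andP[c1 c2].
by lra.
Qed.

HB.instance Definition _ := @isMetric.Build R (cone nu_gg1) cone_dist
  cone_distxx cone_dist_positivity cone_dist_sym cone_dist_triangle.

End AsymptoticCone.

Arguments cone {U R Y} p {nu} nu_gg1.

(* The library's [closed_ball] is the closure of an open ball, which may be
   smaller than the closed ball meant here. *)
Definition proper_metric (R : realType) (X : metricType R) : Prop :=
  forall (x : X) (r : R), compact [set y : X | mdist x y <= r].

Definition geodesic (R : realType) (X : metricType R) : Prop :=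
  forall x y : X, exists (l : R) (gamma : R -> X),
    [/\ 0 <= l, gamma 0 = x, gamma l = y &
        forall t s : R, 0 <= t <= l -> 0 <= s <= l ->
          mdist (gamma t) (gamma s) = `|t - s|].

Definition unbounded (R : realType) (X : metricType R) : Prop :=
  ~ exists r : R, forall x y : X, mdist x y <= r.

Definition isometric (R : realType) (X Y : metricType R) : Prop :=
  exists f : X -> Y,
    bijective f /\ forall x y : X, mdist (f x) (f y) = mdist x y.

Definition is_asymptotic_cone_of (U : nonprincipal_ultrafilter) (R : realType)
    (X Y : metricType R) : Prop :=
  exists (p : star U Y) (nu : star U R)
         (nu_gg1 : star_gg nu (star_const U (1 : R))),
    isometric X (cone p nu_gg1).

(* Main.v *)
(** Let [Y] be the disjoint union of the rescaled copies [(n + 1) X], where a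
    path between two different copies has to leave the [n]-th one through an
    exit at distance at least [n] (before rescaling) from a fixed point [o].
    Seen from [(n, o)] at scale [n + 1], the exits escape to infinity, so that
    the cone of [Y] only sees sequences which eventually stay in the [n]-th
    copy, at bounded distance from [o]; by properness these converge in [X]
    along the ultrafilter.  If [X] is unbounded, the exits can be taken to be
    points [q n] of [X] with [d (o, q n) >= n]; then [Y] is the wedge of the
    pointed spaces [((n + 1) X, q n)], which is geodesic if [X] is. *)

Require Import Defs.
From HB Require Import structures.
From mathcomp Require Import all_boot all_order all_algebra.
From mathcomp Require Import lra.
From mathcomp Require Import all_classical all_reals all_analysis.

Set Implicit Arguments.
Unset Strict Implicit.
Unset Printing Implicit Defensive.

Import Order.TTheory GRing.Theory Num.Theory.
Import numFieldNormedType.Exports.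

Local Open Scope classical_set_scope.
Local Open Scope ring_scope.
Local Open Scope quotient_scope.

(** * Non-principal ultrafilters contain all tails *)

Lemma nonprincipal_ultrafilter_ge (U : nonprincipal_ultrafilter) (N : nat) :
  \forall n \near ufilter U, (N <= n)%N.
Proof.
(* If [{k}] belonged to the ultrafilter, every member would contain [k], making it principal at
   [k]. *)
have neq k : \forall n \near ufilter U, n != k.
  have [Uk|//] := in_ultra_setVsetC [set n | n = k] (ufilter_ultra U); last first.
    by apply: filterS => n /= /eqP.
  case: (@ufilter_nonprincipal U k); apply/seteqP; split=> A.
    move=> UA; apply/principal_filterP.
    by have [n [/= <-]] := filter_ex (filterI Uk UA).
  by move/principal_filterP => Ak; apply: filterS Uk => n /= ->.
elim: N => [|N IHN]; first exact: filterE.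
by apply: filterS2 IHN (neq N) => n Nn nN; rewrite ltn_neqAle eq_sym nN.
Qed.

Lemma nonprincipal_ultrafilter_gt (U : nonprincipal_ultrafilter) (R : realType)
    (r : R) : \forall n \near ufilter U, r < n%:R.
Proof.
apply: filterS (nonprincipal_ultrafilter_ge U (Num.truncn r).+1) => n rn.
by rewrite (lt_le_trans (truncnS_gt r))// ler_nat.
Qed.

Lemma star_div_dist_class (U : nonprincipal_ultrafilter) (R : realType)
    (Y : metricType R) (x y : nat -> Y) (c : nat -> R) :
  star_div (star_dist (star_class U x) (star_class U y)) (star_class U c) =
  star_class U (fun n => mdist (x n) (y n) / c n).
Proof. by rewrite /star_div /star_dist !star_map2_class. Qed.

(** * The metric quotient of a pseudometric *)

Section MetricIdentification.
Variables (R : realType) (T : choiceType) (D : T -> T -> R).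
Hypotheses (Dxx : forall x, D x x = 0) (D_sym : forall x y, D x y = D y x).
Hypothesis D_triangle : forall y x z, D x z <= D x y + D y z.

Lemma pseudometric_ge0 x y : 0 <= D x y.
Proof. by have := D_triangle y x x; rewrite Dxx (D_sym y); lra. Qed.

Let D0 x y := D x y == 0.

Let D0_refl : reflexive D0.
Proof. by move=> x; rewrite /D0 Dxx. Qed.

Let D0_sym : symmetric D0.
Proof. by move=> x y; rewrite /D0 D_sym. Qed.

Let D0_trans : transitive D0.
Proof.
move=> y x z /eqP xy /eqP yz; apply/eqP/le_anti.
by rewrite pseudometric_ge0 andbT (le_trans (D_triangle y _ _))// xy yz addr0.
Qed.

Let D0_equiv := EquivRel D0 D0_refl D0_sym D0_trans.

(** Needed for the glued space: exits lying inside their copies are at mutual distance 0 and have to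
    become one point. *)
Definition metric_ident : Type := {eq_quot D0_equiv}.

HB.instance Definition _ := Choice.copy metric_ident {eq_quot D0_equiv}.

Definition metric_ident_pi (x : T) : metric_ident := \pi_({eq_quot D0_equiv}) x.

Let rep (u : metric_ident) : T := repr (u : {eq_quot D0_equiv}).

Let dist (u v : metric_ident) := D (rep u) (rep v).

Let D_rep_pi x : D (rep (metric_ident_pi x)) x = 0.
Proof.
apply/eqP; rewrite -/(D0 _ _).
have /eqmodP // : \pi_({eq_quot D0_equiv}) (rep (metric_ident_pi x)) =
  \pi_({eq_quot D0_equiv}) x.
exact: reprK.
Qed.

Let dist_xx u : dist u u = 0. Proof. exact: Dxx. Qed.

Let dist_positivity u v : dist u v = 0 -> u = v.
Proof.
move=> /eqP uv; rewrite -[u]reprK -[v]reprK.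
by apply/eqmodP.
Qed.

Let dist_sym u v : dist u v = dist v u. Proof. exact: D_sym. Qed.

Let dist_triangle v u w : dist u w <= dist u v + dist v w.
Proof. exact: D_triangle. Qed.

HB.instance Definition _ := @isMetric.Build R metric_ident dist
  dist_xx dist_positivity dist_sym dist_triangle.

Lemma metric_ident_surj (u : metric_ident) : exists x, metric_ident_pi x = u.
Proof. by exists (rep u); exact: reprK. Qed.

Lemma mdist_metric_ident_pi x y :
  mdist (metric_ident_pi x) (metric_ident_pi y) = D x y.
Proof.
rewrite -[LHS]/(D (rep (metric_ident_pi x)) (rep (metric_ident_pi y))).
set x' := rep _; set y' := rep _.
have hx : D x' x = 0 := D_rep_pi x.
have hy : D y' y = 0 := D_rep_pi y.
have := D_triangle x x' y'; have := D_triangle y x y'.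
have := D_triangle x' x y; have := D_triangle y' x' y.
rewrite (D_sym x x') (D_sym y y') hx hy => h1 h2 h3 h4.
by apply/le_anti/andP; split; lra.
Qed.

End MetricIdentification.

(** * Concatenation of geodesic segments *)

Section GeodesicSegments.
Variable R : realType.

Definition geodesic_segment (X : metricType R) (x y : X) (l : R)
    (gamma : R -> X) :=
  [/\ 0 <= l, gamma 0 = x, gamma l = y &
      forall t s : R, 0 <= t <= l -> 0 <= s <= l ->
        mdist (gamma t) (gamma s) = `|t - s|].

Lemma geodesic_segment_length (X : metricType R) (x y : X) l gamma :
  geodesic_segment x y l gamma -> mdist x y = l.
Proof.
move=> [l0 <- <- ->]; rewrite ?lexx ?l0//.
by rewrite sub0r normrN ger0_norm.
Qed.

(** Going through [z] bounds the distance between points of the two pieces from above; a shorter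
    connection would give a path from [x] to [y] shorter than [mdist x y]. *)
Lemma geodesic_segment_cat (X : metricType R) (x z y : X) l1 l2 g1 g2 :
  mdist x y = mdist x z + mdist z y ->
  geodesic_segment x z l1 g1 -> geodesic_segment z y l2 g2 ->
  geodesic_segment x y (l1 + l2)
    (fun t => if t <= l1 then g1 t else g2 (t - l1)).
Proof.
move=> xzy G1 G2; move: xzy.
rewrite (geodesic_segment_length G1) (geodesic_segment_length G2).
case: G1 G2 => l10 g10 g11 h1 [l20 g20 g21 h2] xy.
have cross t s : 0 <= t <= l1 -> 0 <= s <= l2 ->
    mdist (g1 t) (g2 s) = l1 - t + s.
  move=> /andP[t0 tl] /andP[s0 sl].
  have a1 : mdist (g1 t) z = l1 - t.
    by rewrite -g11 h1 ?t0 ?l10 ?lexx// distrC ger0_norm// subr_ge0.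
  have a2 : mdist z (g2 s) = s.
    by rewrite -g20 h2 ?s0 ?l20 ?lexx// sub0r normrN ger0_norm.
  have a3 : mdist x (g1 t) = t.
    by rewrite -g10 h1 ?t0 ?l10 ?lexx// sub0r normrN ger0_norm.
  have a4 : mdist (g2 s) y = l2 - s.
    by rewrite -g21 h2 ?s0 ?l20 ?lexx// distrC ger0_norm// subr_ge0.
  have b1 := metric_triangle (g1 t) z (g2 s).
  have b2 := metric_triangle x (g1 t) y.
  have b3 := metric_triangle (g1 t) (g2 s) y.
  by apply/le_anti/andP; split; lra.
split; first by rewrite addr_ge0.
- by rewrite l10.
- case: ifPn => [l2l|_]; last by rewrite addrAC subrr add0r.
  (* The endpoint falls under the first branch only if the second segment is a single point. *)
  have l2E : l2 = 0 by lra.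
  by rewrite -g21 l2E g20 addr0.
- move=> t s /andP[t0 tl] /andP[s0 sl].
  case: (leP t l1) => tl1; case: (leP s l1) => sl1.
  + by rewrite h1// ?t0 ?s0.
  + by rewrite cross ?t0//; [rewrite distrC ger0_norm; lra|lra].
  + by rewrite metric_sym cross ?s0//; [rewrite ger0_norm; lra|lra].
  + by rewrite h2; [congr `|_|; lra|lra|lra].
Qed.

End GeodesicSegments.

(** * Gluing the rescaled copies at their exits *)

Section Gluing.
Variables (R : realType) (X : metricType R).
(* [h n x] is the distance from [x] to the exit of the [n]-th copy. *)
Variable h : nat -> X -> R.
(** With [h_sep], this makes [h n] a Katetov function: it is the distance to a point that may be
    adjoined to [X], so the exit need not lie in [X]. *)
Hypothesis h_lip : forall n x y, h n x <= mdist x y + h n y.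
Hypothesis h_sep : forall n x y, mdist x y <= h n x + h n y.

(** All exits are at distance 0 from each other. The factor [n.+1] keeps the copy of index 0 from
    collapsing. *)
Definition glue_dist (a b : nat * X) : R :=
  if a.1 == b.1 then a.1.+1%:R * mdist a.2 b.2
  else a.1.+1%:R * h a.1 a.2 + b.1.+1%:R * h b.1 b.2.

Let h_ge0 n x : 0 <= h n x.
Proof. by have := h_sep n x x; rewrite mdistxx; lra. Qed.

Lemma glue_distxx a : glue_dist a a = 0.
Proof. by rewrite /glue_dist eqxx mdistxx mulr0. Qed.

Lemma glue_dist_sym a b : glue_dist a b = glue_dist b a.
Proof.
rewrite /glue_dist eq_sym; case: eqP => [->|_]; first by rewrite metric_sym.
exact: addrC.
Qed.

(** If [b] shares the copy of exactly one of [a] and [c], [h_lip] suffices; [h_sep] handles a detour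
    that leaves a copy and comes back. *)
Lemma glue_dist_triangle b a c : glue_dist a c <= glue_dist a b + glue_dist b c.
Proof.
case: a b c => [n x] [m y] [k z]; rewrite /glue_dist /=.
have [<-|nm] := eqVneq n m.
  case: eqP => _; first by rewrite -mulrDr ler_wpM2l// metric_triangle.
  by rewrite addrA lerD2r -mulrDr ler_wpM2l.
have [<-|mk] := eqVneq m k.
  rewrite (negPf nm) -addrA lerD2l -mulrDr ler_wpM2l//.
  by rewrite addrC metric_sym.
have m0 : 0 <= m.+1%:R * h m y by rewrite mulr_ge0.
case: eqP => [<-|_]; last by lra.
have := ler_wpM2l (ler0n R n.+1) (h_sep n x z).
by lra.
Qed.

Definition glued : metricType R :=
  metric_ident glue_distxx glue_dist_sym glue_dist_triangle.

Definition glue_pt (n : nat) (x : X) : glued :=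
  metric_ident_pi glue_distxx glue_dist_sym glue_dist_triangle (n, x).

Lemma glue_pt_surj (u : glued) : exists n x, glue_pt n x = u.
Proof. by have [[n x] <-] := metric_ident_surj u; exists n, x. Qed.

Lemma mdist_glue_pt n m x y :
  mdist (glue_pt n x) (glue_pt m y) = glue_dist (n, x) (m, y).
Proof. exact: mdist_metric_ident_pi. Qed.

Lemma mdist_glue_pt_same n x y :
  mdist (glue_pt n x) (glue_pt n y) = n.+1%:R * mdist x y.
Proof. by rewrite mdist_glue_pt /glue_dist eqxx. Qed.

Lemma geodesic_segment_glue_pt n x y l gamma : geodesic_segment x y l gamma ->
  geodesic_segment (glue_pt n x) (glue_pt n y) (n.+1%:R * l)
    (fun t => glue_pt n (gamma (t / n.+1%:R))).
Proof.
have n0 : 0 < n.+1%:R :> R by rewrite ltr0n.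
move=> [l0 g0 gl hg]; split.
- by rewrite mulr_ge0.
- by rewrite mul0r g0.
- by rewrite mulrAC divff ?gt_eqF// mul1r gl.
- move=> t s tl sl; rewrite mdist_glue_pt_same hg.
  + rewrite -mulrBl normrM normfV (ger0_norm (ltW n0)).
    by rewrite mulrCA divff ?gt_eqF// mulr1.
  + by rewrite ler_pdivrMr// [l * _]mulrC divr_ge0 ?(ltW n0)//=; case/andP: tl.
  + by rewrite ler_pdivrMr// [l * _]mulrC divr_ge0 ?(ltW n0)//=; case/andP: sl.
Qed.

(** A zero of [h n] is an exit inside [X]. All these exits become one point, and geodesics between
    different copies are concatenated there. *)
Lemma glued_geodesic : (forall n, exists q, h n q = 0) ->
  geodesic X -> geodesic glued.
Proof.
move=> hq gX u v.
have [n [x <-]] := glue_pt_surj u; have [m [y <-]] := glue_pt_surj v.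
suff [l [g G]] : exists l g, geodesic_segment (glue_pt n x) (glue_pt m y) l g.
  by exists l, g.
have [->|nm] := eqVneq n m.
  have [l [g G]] := gX x y; exists (m.+1%:R * l).
  by eexists; exact: (geodesic_segment_glue_pt m G).
have [q hnq] := hq n; have [q' hmq'] := hq m.
have h_dist k z w : h k w = 0 -> h k z = mdist z w.
  move=> hw; have := h_lip k z w; have := h_sep k z w; rewrite hw => ? ?.
  by apply/le_anti/andP; split; lra.
have qq' : glue_pt m q' = glue_pt n q.
  apply: mdist_positivity.
  by rewrite mdist_glue_pt /glue_dist eq_sym/= (negPf nm) hnq hmq' !mulr0 addr0.
have [l1 [g1 G1]] := gX x q; have [l2 [g2 G2]] := gX q' y.
have {}G1 := geodesic_segment_glue_pt n G1.
have := geodesic_segment_glue_pt m G2; rewrite qq' => {}G2.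
eexists; eexists; apply: geodesic_segment_cat G1 G2.
rewrite -{2}qq' !mdist_glue_pt_same mdist_glue_pt /glue_dist/= (negPf nm).
by rewrite (h_dist _ _ _ hnq) (h_dist _ _ _ hmq') (metric_sym y).
Qed.

(** * The asymptotic cone of the glued space *)

Variables (U : nonprincipal_ultrafilter) (o : X).
Hypothesis X_proper : proper_metric X.
Hypothesis h_o : forall n, n%:R <= h n o.

Let p : star U glued := star_class U (fun n => glue_pt n o).
Let nu : star U R := star_class U (fun n => n.+1%:R).

Let nu_gg1 : star_gg nu (star_const U (1 : R)).
Proof.
split.
- by apply/star_rel_class; apply: filterE.
- by apply/star_rel_class; apply: filterE.
- rewrite /star_div star_map2_class => /finite_class[r hr].
  have [n [/= + rn]] := filter_ex (filterI hr (nonprincipal_ultrafilter_gt U r)).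
  by rewrite divr1 ger0_norm// -natr1; lra.
Qed.

Let cone_seq (x : X) : star U glued := star_class U (fun n => glue_pt n x).

Let cone_seq_bigO x : star_bigO (star_dist (cone_seq x) p) nu.
Proof.
rewrite /star_bigO star_div_dist_class.
apply/finite_class; exists (mdist x o); apply: filterE => n /=.
rewrite mdist_glue_pt_same mulrAC divff ?mul1r ?pnatr_eq0//.
by rewrite ger0_norm ?mdist_ge0.
Qed.

Let f (x : X) : cone p nu_gg1 := cone_point nu_gg1 (cone_seq_bigO x).

Let f_isometry x y : mdist (f x) (f y) = mdist x y.
Proof.
rewrite -[LHS]/(cone_dist _ _) cone_dist_point star_div_dist_class.
apply: st_class => e e0; apply: filterE => n /=.
by rewrite mdist_glue_pt_same mulrAC divff ?mul1r ?pnatr_eq0// subrr normr0.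
Qed.

(** The image of the ultrafilter under [x] contains a compact closed ball, so it has a cluster point
    [a]. For each [e], either [mdist (x n) a < e] holds almost everywhere or its negation does, and
    the latter contradicts clustering. *)
Lemma ultrafilter_bounded_cvg (x : nat -> X) (r : R) :
  (\forall n \near ufilter U, mdist (x n) o <= r) ->
  exists a, forall e : R, 0 < e -> \forall n \near ufilter U, mdist (x n) a < e.
Proof.
move=> xr; pose F : set_system X := x @ ufilter U.
have FF : ProperFilter F by exact: fmap_proper_filter.
have Fr : F [set y | mdist o y <= r].
  by apply: filterS xr => n /=; rewrite metric_sym.
have [a [_ cFa]] := X_proper FF Fr.
exists a => e e0.
have [//|nUe] := in_ultra_setVsetC [set n | mdist (x n) a < e]
  (ufilter_ultra U).
have [y [ay ya]] : ([set y : X | ~ mdist y a < e] `&` ball a e) !=set0.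
  by apply: cFa; [exact: nUe|exact: nbhsx_ballx].
by move: ya; rewrite ballEmdist /= metric_sym.
Qed.

Let f_surj u : exists x, f x = u.
Proof.
pose y := star_repr (cone_repr u).
have yE : star_class U y = cone_repr u by rewrite star_reprK.
have hy n : exists mx : nat * X, glue_pt mx.1 mx.2 = y n.
  by have [m [x <-]] := glue_pt_surj (y n); exists (m, x).
have [z zy] := choice hy.
have zE : (fun n => glue_pt (z n).1 (z n).2) = y by apply/funext.
have [r hr] : exists r : R, \forall n \near ufilter U,
    mdist (glue_pt (z n).1 (z n).2) (glue_pt n o) <= r * n.+1%:R.
  have := cone_reprP u; rewrite -yE -zE.
  rewrite /star_bigO star_div_dist_class.
  move=> /finite_class[r hr]; exists r; apply: filterS hr => n /=.
  by rewrite ger0_norm ?divr_ge0 ?mdist_ge0// ler_pdivrMr.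
(* A point outside the [n]-th copy is at distance at least [n.+1%:R * h n o], hence at least
   [n.+1%:R * n%:R], from the basepoint; this exceeds the bound once [r < n%:R]. *)
have zn : \forall n \near ufilter U, (z n).1 = n.
  apply: filterS2 hr (nonprincipal_ultrafilter_gt U r) => n.
  rewrite mdist_glue_pt /glue_dist /=; case: eqP => // _ znr rn; exfalso.
  suff : r * n.+1%:R < (z n).1.+1%:R * h (z n).1 (z n).2 + n.+1%:R * h n o.
    by rewrite ltNge znr.
  apply: (@lt_le_trans _ _ (n.+1%:R * h n o)); last by rewrite lerDr mulr_ge0.
  by rewrite mulrC ltr_pM2l ?ltr0n// (lt_le_trans rn).
(* Inside the [n]-th copy the factor [n.+1] cancels, so the points [(z n).2] stay within [r] of [o]
   in [X]. *)
have [a za] : exists a, forall e : R, 0 < e ->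
    \forall n \near ufilter U, mdist (z n).2 a < e.
  apply: (@ultrafilter_bounded_cvg _ r).
  apply: filterS2 hr zn => n + zn1; rewrite zn1 mdist_glue_pt_same.
  by rewrite mulrC ler_pM2r.
exists a; apply: val_inj; rewrite -(cone_class_repr u) /=.
apply/cone_classP; rewrite -yE -zE.
rewrite /star_littleo star_div_dist_class.
apply/infinitesimal_class => e e0; apply: filterS2 (za e e0) zn => n /= + ->.
rewrite mdist_glue_pt_same mulrAC divff ?mul1r ?pnatr_eq0//.
by rewrite ger0_norm ?mdist_ge0// metric_sym.
Qed.

Lemma glued_asymptotic_cone : is_asymptotic_cone_of U X glued.
Proof.
exists p, nu, nu_gg1, f; split; last exact: f_isometry.
have [g fg] := choice f_surj.
exists g => [x|]; last exact: fg.
by apply: mdist_positivity; rewrite -f_isometry fg mdistxx.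
Qed.

End Gluing.

(** * The two choices of exits *)

Theorem theorem5p14 (U : nonprincipal_ultrafilter) (R : realType)
    (X : metricType R) (X_nonempty : [set: X] !=set0)
    (X_proper : proper_metric X) :
  (exists Y : metricType R, is_asymptotic_cone_of U X Y) /\
  (geodesic X -> unbounded X ->
    exists Y : metricType R, geodesic Y /\ is_asymptotic_cone_of U X Y).
Proof.
case: X_nonempty => o _; split.
  (* The exit is the free end of a whisker of length [n] attached at [o], with only its end used for
     gluing. *)
  pose h n (x : X) : R := mdist x o + n%:R.
  have h_lip (n : nat) (x y : X) : h n x <= mdist x y + h n y.
    by rewrite addrA lerD2r metric_triangle.
  have h_sep (n : nat) (x y : X) : mdist x y <= h n x + h n y.
    have := metric_triangle x o y; rewrite (metric_sym o y) /h.
    by have : 0 <= n%:R :> R by []; lra.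
  exists (glued h_lip h_sep); apply: (@glued_asymptotic_cone _ _ _ _ _ _ o) => //.
  by move=> n; rewrite /h mdistxx add0r.
move=> gX uX.
have far_point n : exists q : X, n%:R <= mdist q o.
  (* Otherwise [X] lies in the ball of radius [n] about [o], and its diameter is at most [2n]. *)
  apply: contrapT => nq; apply: uX; exists (n%:R + n%:R) => x y.
  have le_n z : mdist z o <= n%:R.
    by rewrite leNgt; apply/negP => /ltW nz; apply: nq; exists z.
  by rewrite (le_trans (metric_triangle _ o _))// lerD// metric_sym.
have [q hq] := choice far_point.
(* Now the exit is the point [q n] of [X] itself, so [h n] has a zero. *)
pose h n (x : X) : R := mdist x (q n).
have h_lip (n : nat) (x y : X) : h n x <= mdist x y + h n y by exact: metric_triangle.
have h_sep (n : nat) (x y : X) : mdist x y <= h n x + h n y.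
  by rewrite /h (metric_sym y) metric_triangle.
exists (glued h_lip h_sep); split.
  by apply: glued_geodesic => // n; exists (q n); exact: mdistxx.
apply: (@glued_asymptotic_cone _ _ _ _ _ _ o) => // n.
by rewrite /h metric_sym.
Qed.
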